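(* Let $A\subset\mathbb N$ be a classical normal set. For given $a\in\mathbb N$ define $$S_a=\{b\in\mathbb N: a+b\in A,\ ab\in A\}.$$ Then for every $a\in\mathbb N$ either $S_a$ or $S_{a^2}$ has positive upper density. In particular, $A$ contains pairs $\{a+b,ab\}$ with arbitrarily large $a$ and $b$.
   Context: $\mathbb N=\{1,2,\dots\}$. A set $A\subset\mathbb N$ is classical normal if its indicator sequence $x=\mathbf 1_A\in\{0,1\}^{\mathbb N}$ is normal: for every $k\in\mathbb N$ and every word $w\in\{0,1\}^k$, $\lim_{n\to\infty}\frac1n|\{m\in\{1,\dots,n-k+1\}:\langle x_m,\dots,x_{m+k-1}\rangle=w\}|=2^{-k}$. The upper density of $V\subset\mathbb N$ is $\limsup_n\frac1n|V\cap\{1,\dots,n\}|$. *)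

(* Defs.v *)
From HB Require Import structures.
From mathcomp Require Import all_boot all_order all_algebra.
From mathcomp Require Import all_classical all_reals all_analysis.
Import Order.TTheory GRing.Theory Num.Theory.
Import numFieldNormedType.Exports.

Set Implicit Arguments.
Unset Strict Implicit.
Unset Printing Implicit Defensive.

Local Open Scope classical_set_scope.
Local Open Scope ring_scope.

Definition posN : set nat := [set n | (0 < n)%N].

(* A sequence indexed by 1, 2, ... is a function on nat whose value at 0 is
   never read: [iota 1 n] lists 1, ..., n. *)
Definition block_count (x : nat -> bool) (k : nat) (w : k.-tuple bool)
    (n : nat) : nat :=
  count (fun m => [seq x j | j <- iota m k] == w) (iota 1 (n.+1 - k)).

Definition normal_seq (R : realType) (x : nat -> bool) : Prop :=
  forall (k : nat) (w : k.-tuple bool), (0 < k)%N ->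
    (fun n : nat => (block_count x w n)%:R / n%:R : R) @ \oo --> (2 ^- k : R).

Definition classical_normal (R : realType) (A : set nat) : Prop :=
  normal_seq R (fun m => m \in A).

Definition upper_density (R : realType) (V : set nat) : R :=
  limn_sup (fun n : nat => (count (fun m => m \in V) (iota 1 n))%:R / n%:R).

Definition S_ (A : set nat) (a : nat) : set nat :=
  [set b | [/\ posN b, A (a + b)%N & A (a * b)%N]].

(* Main.v *)
Require Import Defs.
From mathcomp Require Import all_boot all_order all_algebra.
From mathcomp Require Import all_classical all_reals all_analysis.
From mathcomp Require Import zify ring lra.
Import Order.TTheory GRing.Theory Num.Theory.
Import numFieldNormedType.Exports.

Set Implicit Arguments.
Unset Strict Implicit.
Unset Printing Implicit Defensive.

Local Open Scope classical_set_scope.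
Local Open Scope ring_scope.

(** Encode [A] by the signs [x m = 1] if [m] is in [A] and [-1] otherwise, and
let the mean of a sequence be its Cesaro average over [1, ..., n].

Normality is used only through two consequences: [x] has mean [0], and the
correlations [x (m + i) * x (m + j)] have mean [0] for [i != j]
([cvg_mean_sgn], [cvg_mean_sgnM]).  These already imply that [x] has mean [0]
along the multiples of [a] ([cvg_mean_multiples0]), by a second moment argument
in the style of van der Corput.

Suppose now that both [S_a] and [S_(a^2)] have upper density [0].  The
translate [A - a] and the dilate [A / a] both have density [1/2], and their
intersection [S_a] is null, so each is the complement of the other up to a null
set: [x (a b) = - x (a + b)] for almost every [b] ([cvg_mean_agree0]).  Applying
this relation at [a b] and at [b + 1] gives, for almost every [b],

  [x (a^2 b) = - x (a b + a) = - x (a (b + 1)) = x (a + b + 1)].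

As [S_(a^2)] is null, [x (a^2 b)] and [x (a^2 + b)] are almost never both [1],
so the same holds for [x (a + 1 + b)] and [x (a^2 + b)].  But [a + 1] differs
from [a^2], so by the vanishing of correlations these two are both [1] on a set
of density [1/4], a contradiction.  The last claim follows because a set of
positive upper density is unbounded. *)

(** * Cesaro means *)

Section Mean.
Context {R : realType}.
Implicit Types (f g : nat -> R) (n : nat).

Definition mean f n : R := (\sum_(1 <= m < n.+1) f m) / n%:R.

Lemma eq_mean f g : (forall m, (0 < m)%N -> f m = g m) -> mean f = mean g.
Proof.
move=> fg; apply/funext => n; congr (_ / _).
by apply: eq_big_nat => m /andP[m0 _]; exact: fg.
Qed.

Lemma ler_mean f g n : (forall m, (0 < m)%N -> f m <= g m) ->
  mean f n <= mean g n.
Proof.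
move=> fg; rewrite ler_wpM2r ?invr_ge0//.
by apply: ler_sum_nat => m /andP[m0 _]; exact: fg.
Qed.

Lemma mean_ge0 f n : (forall m, (0 < m)%N -> 0 <= f m) -> 0 <= mean f n.
Proof.
move=> f0; rewrite divr_ge0//.
rewrite big_seq; apply: sumr_ge0 => m.
by rewrite mem_index_iota => /andP[m0 _]; exact: f0.
Qed.

Lemma meanD f g n : mean (fun m => f m + g m) n = mean f n + mean g n.
Proof. by rewrite /mean big_split mulrDl. Qed.

Lemma meanZ (c : R) f n : mean (fun m => c * f m) n = c * mean f n.
Proof. by rewrite /mean -mulr_sumr mulrA. Qed.

Lemma mean_sum (I : finType) (F : I -> nat -> R) n :
  mean (fun m => \sum_i F i m) n = \sum_i mean (F i) n.
Proof. by rewrite /mean exchange_big mulr_suml. Qed.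

Lemma mean_cst (c : R) n : (0 < n)%N -> mean (fun=> c) n = c.
Proof.
move=> n0; rewrite /mean sumr_const_nat subn1/= -[c *+ n]mulr_natr mulfK//.
by rewrite pnatr_eq0 -lt0n.
Qed.

Lemma mean_le_cst f (c : R) n : (0 < n)%N ->
  (forall m, (0 < m)%N -> f m <= c) -> mean f n <= c.
Proof. by move=> n0 fc; rewrite -[leRHS](mean_cst c n0); exact: ler_mean. Qed.

Lemma ler_norm_mean f n : `|mean f n| <= mean (fun m => `|f m|) n.
Proof.
by rewrite normrM normfV normr_nat ler_wpM2r ?invr_ge0// ler_norm_sum.
Qed.

Lemma cvg_sum_fin (I : finType) (u : I -> nat -> R) (l : I -> R) :
  (forall i, u i @ \oo --> l i) ->
  (fun n => \sum_i u i n) @ \oo --> \sum_i l i.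
Proof.
move=> ul; elim: (index_enum I) => [|i r ih].
  by under eq_fun do rewrite big_nil; rewrite big_nil; exact: cvg_cst.
by under eq_fun do rewrite big_cons; rewrite big_cons; exact: cvgD.
Qed.

Lemma cvg_mean_cst (c : R) : mean (fun=> c) @ \oo --> c.
Proof.
apply: cvg_near_cst; near=> n; rewrite mean_cst//; near: n.
exact: nbhs_infty_gt.
Unshelve. all: by end_near. Qed.

(** One step of the shift telescopes: it changes the sum by two terms only. *)
Lemma cvg_mean_shiftB f (c : R) (j : nat) : (forall m, `|f m| <= c) ->
  (fun n => mean (fun m => f (m + j)%N) n - mean f n) @ \oo --> 0.
Proof.
move=> fc; elim: j => [|j ih].
  under eq_fun => n do under eq_mean do rewrite addn0.
  by under eq_fun => n do rewrite subrr; exact: cvg_cst.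
have step : (fun n => mean (fun m => f (m + j.+1)%N) n -
                      mean (fun m => f (m + j)%N) n) @ \oo --> 0.
  apply: norm_cvg0.
  have h2 : (fun n => (4 * c) * @harmonic R n) @ \oo --> 0.
    by rewrite -[X in _ --> X](mulr0 (4 * c)); apply: cvgMl_tmp; exact: cvg_harmonic.
  apply: (squeeze_cvgr _ (cvg_cst 0) h2).
  near=> n; rewrite normr_ge0/=.
  have n0 : (0 < n)%N by near: n; exact: nbhs_infty_gt.
  rewrite /mean -mulrBl -sumrB.
  under eq_bigr do rewrite addnS.
  rewrite (telescope_sumr (fun m => f (m + j)%N))//=.
  rewrite normrM normfV normr_nat /harmonic.
  have : `|f (n.+1 + j)%N - f (1 + j)%N| <= 2 * c.
    by rewrite (le_trans (ler_normB _ _))// mulr_natl mulr2n lerD.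
  have c0 : 0 <= c by rewrite (le_trans _ (fc 0%N)).
  move=> h; rewrite ler_pdivrMr ?ltr0n// (le_trans h)//.
  rewrite mulrAC ler_pdivlMr// ?ltr0n//.
  have : (1 : R) <= n%:R by rewrite ler1n.
  rewrite -natr1; nra.
rewrite -[X in _ --> X](addr0 0).
under eq_fun => n do rewrite -(subrKA (mean (fun m => f (m + j)%N) n)).
exact: cvgD.
Unshelve. all: by end_near. Qed.

Lemma cvg_mean_shift f (c l : R) (j : nat) : (forall m, `|f m| <= c) ->
  mean f @ \oo --> l -> mean (fun m => f (m + j)%N) @ \oo --> l.
Proof.
move=> fc fl.
have -> : mean (fun m => f (m + j)%N) =
    fun n => (mean (fun m => f (m + j)%N) n - mean f n) + mean f n.
  by apply/funext => n; rewrite subrK.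
by rewrite -[l]add0r; apply: cvgD => //; exact: cvg_mean_shiftB fc.
Qed.

(** The [n] multiples of [a] up to [a * n] are only some of the terms of the mean
at [a * n], and the two normalizations differ by a factor [a]. *)
Lemma mean_dilate_le f (a n : nat) : (0 < a)%N -> (forall m, 0 <= f m) ->
  mean (fun b => f (a * b)%N) n <= a%:R * mean f (a * n)%N.
Proof.
move=> a0 f0; case: n => [|n]; first by rewrite /mean invr0 !mulr0 muln0 invr0 !mulr0.
have -> : a%:R * mean f (a * n.+1)%N =
    (\sum_(1 <= m < (a * n.+1).+1) f m) / n.+1%:R.
  by rewrite /mean natrM; field; rewrite pnatr_eq0 -lt0n a0 nat1r pnatr_eq0.
rewrite ler_wpM2r ?invr_ge0//.
elim: n.+1 => [|k ih]; first by rewrite muln0 !big_geq.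
rewrite big_nat_recr//= [leRHS](@big_cat_nat _ _ _ (a * k).+1)//=; last first.
  by rewrite ltnS leq_mul2l leqnSn orbT.
rewrite lerD//.
rewrite mulnS addnC -(prednK a0) addnS big_nat_recr /=; last by lia.
by rewrite lerDr sumr_ge0.
Qed.

Lemma cvg_dilate (u : nat -> R) (l : R) (a : nat) : (0 < a)%N ->
  u @ \oo --> l -> (fun n => u (a * n)%N) @ \oo --> l.
Proof.
move=> a0 ul; apply: (cvg_comp (fun n => (a * n)%N) u _ ul).
apply/cvgnyPge => B; near=> n.
have : (B <= n)%N by near: n; exact: nbhs_infty_ge.
by move=> /leq_trans; apply; exact: leq_pmull.
Unshelve. all: by end_near. Qed.

Lemma cvg_mean_dilate0 f (a : nat) : (0 < a)%N -> (forall m, 0 <= f m) ->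
  mean f @ \oo --> 0 -> mean (fun b => f (a * b)%N) @ \oo --> 0.
Proof.
move=> a0 f0 fl.
have h : (fun n => a%:R * mean f (a * n)%N) @ \oo --> 0.
  by rewrite -[X in _ --> X](mulr0 a%:R); apply: cvgMl_tmp; exact: cvg_dilate.
apply: (squeeze_cvgr _ (cvg_cst 0) h); apply: nearW => n.
by rewrite mean_ge0 ?mean_dilate_le.
Qed.

(** Averaging over [K] consecutive multiples does not change the limit of the
mean of [y b = f (a * b)], so it suffices to bound the mean of the block sums
[G K b = \sum_(j < K) y (b + j)].  These are the values at [a * b] of the sums
[H K m] of [f] along the progression [m, m + a, ..., m + a * (K - 1)].  Since
the correlations vanish, [H K ^+ 2] has mean [K] over all [m], hence upper mean
at most [a * K] over the multiples of [a]: [K^-1 * G K] has mean square at most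
[a / K], which is small for large [K]. *)
Lemma cvg_mean_multiples0 f (a : nat) : (0 < a)%N -> (forall m, f m ^+ 2 = 1) ->
  (forall i j, i != j -> mean (fun m => f (m + i)%N * f (m + j)%N) @ \oo --> 0) ->
  mean (fun b => f (a * b)%N) @ \oo --> 0.
Proof.
move=> a0 f1 fcor.
have fn m : `|f m| = 1.
  by have := f1 m; rewrite -real_normK ?num_real// => /eqP; rewrite sqrf_eq1 =>
    /orP[/eqP//|/eqP h]; have := normr_ge0 (f m); rewrite h oppr_ge0 ler10.
pose H K m : R := \sum_(j < K) f (m + a * j)%N.
have HK K : mean (fun m => H K m ^+ 2) @ \oo --> (K%:R : R).
  have -> : mean (fun m => H K m ^+ 2) = fun n => \sum_(i < K) \sum_(j < K)
      mean (fun m => f (m + a * i)%N * f (m + a * j)%N) n.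
    apply/funext => n; under eq_bigr do rewrite -mean_sum.
    rewrite -mean_sum; congr (_ n); apply: eq_mean => m _.
    rewrite expr2 /H big_distrl/=.
    by apply: eq_bigr => i _; rewrite big_distrr.
  rewrite [X in _ --> X](_ : _ = \sum_(i < K) \sum_(j < K) (i == j)%:R); last first.
    rewrite -[in LHS](card_ord K) -sum1_card natr_sum; apply: eq_bigr => i _.
    rewrite (bigD1 i)//= eqxx big1 ?addr0// => j.
    by rewrite eq_sym => /negbTE ->.
  apply: cvg_sum_fin => i; apply: cvg_sum_fin => j.
  have [->|ij] := eqVneq i j.
    rewrite (eq_mean (g := fun=> 1)); first exact: cvg_mean_cst.
    by move=> m _; rewrite -expr2 f1.
  apply: fcor; apply: contra ij => /eqP h; apply/eqP/val_inj => /=.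
  by move: h => /eqP; rewrite eqn_pmul2l// => /eqP.
pose y b := f (a * b)%N.
pose G K b := H K (a * b)%N.
have avgG K : (0 < K)%N ->
    (fun n => mean y n - K%:R^-1 * mean (G K) n) @ \oo --> 0.
  move=> K0.
  have -> : (fun n => mean y n - K%:R^-1 * mean (G K) n) = fun n =>
      - K%:R^-1 * \sum_(j < K) (mean (fun b => y (b + j)%N) n - mean y n).
    apply/funext => n; rewrite sumrB -mean_sum sumr_const card_ord.
    rewrite (@eq_mean (G K) (fun m => \sum_(i < K) y (m + i)%N)); last first.
      by move=> b _; apply: eq_bigr => j _; rewrite /y mulnDr.
    rewrite -mulr_natl; field; by rewrite pnatr_eq0 -lt0n.
  rewrite -[X in _ --> X](mulr0 (- K%:R^-1)); apply: cvgMl_tmp.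
  rewrite [X in _ --> X](_ : 0 = \sum_(j < K) 0); last by rewrite big1.
  apply: cvg_sum_fin => j; apply: (@cvg_mean_shiftB _ 1) => m.
  by rewrite fn.
apply/cvgr0Pnorm_lt => c c0.
(* By [t <= c / 2 + t ^+ 2 / (2 * c)], the mean of [`|K^-1 * G K|] is eventually
   about [c / 2 + a / (2 * c * K)] at most; this is below [c] iff
   [a / c ^+ 2 < K]. *)
pose K := (Num.truncn (a%:R / c ^+ 2)).+1.
have KR : a%:R / c ^+ 2 < K%:R by exact: truncnS_gt.
have K0 : 0 < K%:R :> R by rewrite ltr0n.
pose B n := `|mean y n - K%:R^-1 * mean (G K) n| +
  (c / 2 + a%:R / (2 * c * K%:R ^+ 2) * mean (fun m => H K m ^+ 2) (a * n)%N).
have Bl : B @ \oo --> 0 + (c / 2 + a%:R / (2 * c * K%:R ^+ 2) * K%:R).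
  apply: cvgD; first by apply/norm_cvg0P; exact: avgG.
  apply: cvgD; first exact: cvg_cst.
  by apply: cvgMl_tmp; apply: cvg_dilate.
have Bc : 0 + (c / 2 + a%:R / (2 * c * K%:R ^+ 2) * K%:R) < c.
  have -> : a%:R / (2 * c * K%:R ^+ 2) * K%:R = a%:R / c ^+ 2 / K%:R * (c / 2).
    by field; rewrite !gt_eqF.
  have : a%:R / c ^+ 2 / K%:R < 1 by rewrite ltr_pdivrMr// mul1r.
  nra.
near=> n.
have n0 : (0 < n)%N by near: n; exact: nbhs_infty_gt.
apply: (@le_lt_trans _ _ (B n)); last by near: n; exact: cvgr_lt Bl _ Bc.
rewrite -{1}(subrK (K%:R^-1 * mean (G K) n) (mean _ n)).
rewrite (le_trans (ler_normD _ _))// lerD2l.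
rewrite -meanZ (le_trans (ler_norm_mean _ _))//.
apply: (@le_trans _ _ (mean (fun b => c / 2 + (2 * c * K%:R ^+ 2)^-1 * G K b ^+ 2) n)).
  apply: ler_mean => b _.
  have -> : (2 * c * K%:R ^+ 2)^-1 * G K b ^+ 2 =
      `|K%:R^-1 * G K b| ^+ 2 / (2 * c).
    by rewrite real_normK ?num_real//; field; rewrite !gt_eqF.
  set t := `|_|.
  rewrite -subr_ge0.
  have -> : c / 2 + t ^+ 2 / (2 * c) - t = (c - t) ^+ 2 / (2 * c).
    by field; rewrite gt_eqF.
  by rewrite divr_ge0 ?sqr_ge0// mulr_ge0// ltW.
rewrite meanD mean_cst// lerD2l meanZ [leRHS]mulrAC [leRHS]mulrC.
rewrite ler_wpM2l ?invr_ge0 ?mulr_ge0 ?sqr_ge0 ?(ltW c0)//.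
by apply: (@mean_dilate_le (fun m => H K m ^+ 2)) => // m; exact: sqr_ge0.
Unshelve. all: by end_near. Qed.

End Mean.

(** * Correlations of a normal sequence *)

Section Normal.
Context {R : realType}.
Implicit Types x : nat -> bool.

Definition sgn_of (b : bool) : R := if b then 1 else -1.

Lemma sgn_ofN b : sgn_of (~~ b) = - sgn_of b.
Proof. by case: b; rewrite /sgn_of/= ?opprK. Qed.

Lemma sgn_of_sqr b : sgn_of b ^+ 2 = 1.
Proof. by case: b; rewrite /sgn_of/= ?sqrrN expr1n. Qed.

Definition window x (k m : nat) : k.-tuple bool := [tuple of map x (iota m k)].

Lemma tnth_window x k m (i : 'I_k) : tnth (window x k m) i = x (m + i)%N.
Proof.
by rewrite tnth_map (tnth_nth 0%N)/= nth_iota.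
Qed.

Lemma sum_block_count x k (F : k.-tuple bool -> R) n :
  \sum_w F w * (block_count x w n)%:R =
  \sum_(1 <= m < (n.+1 - k).+1) F (window x k m).
Proof.
rewrite /index_iota subn1/=.
under eq_bigr => w _.
  rewrite /block_count -sum1_count natr_sum big_mkcond big_distrr/=.
over.
rewrite exchange_big/=; apply: eq_bigr => m _.
rewrite (bigD1 (window x k m))//= eqxx mulr1 big1 ?addr0// => w.
by rewrite eq_sym => /negbTE; rewrite -val_eqE/= => ->; rewrite mulr0.
Qed.

(** All words have the same limiting frequency, so a window statistic averages to
its mean over all words.  Only the windows contained in [1, ..., N] are counted by [block_count];
evaluating at [N = n + k - 1] yields exactly the [n] windows of the mean, and
the denominators [n] and [n + k - 1] differ by a factor of at most [k]. *)
Lemma cvg_mean_window x k (F : k.-tuple bool -> R) : normal_seq R x ->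
  (0 < k)%N -> \sum_w F w = 0 ->
  mean (fun m => F (window x k m)) @ \oo --> 0.
Proof.
move=> nx k0 F0.
pose u n := \sum_w F w * ((block_count x w n)%:R / n%:R).
have u0 : u @ \oo --> 0.
  rewrite [X in _ --> X](_ : 0 = \sum_w F w * 2 ^- k).
    by apply: cvg_sum_fin => w; apply: cvgMl_tmp; exact: nx.
  by rewrite -big_distrl/= F0 mul0r.
apply: norm_cvg0.
have h : (fun n => k%:R * `|u (n + k.-1)%N|) @ \oo --> 0.
  rewrite -[X in _ --> X](mulr0 k%:R); apply: cvgMl_tmp.
  by apply/norm_cvg0P; rewrite cvg_shiftn.
apply: (squeeze_cvgr _ (cvg_cst 0) h); near=> n; rewrite normr_ge0/=.
have n0 : (0 < n)%N by near: n; exact: nbhs_infty_gt.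
rewrite /u; under [in leRHS]eq_bigr do rewrite mulrA.
rewrite -big_distrl/= sum_block_count.
have -> : ((n + k.-1).+1 - k)%N = n by lia.
rewrite /mean !normrM !normfV !normr_nat mulrCA ler_wpM2l//.
rewrite ler_pdivlMr ?ltr0n ?addn_gt0 ?n0// mulrC ler_pdivrMr ?ltr0n//.
rewrite -natrM ler_nat.
nia.
Unshelve. all: by end_near. Qed.

Definition flip k (i : 'I_k) (w : k.-tuple bool) : k.-tuple bool :=
  [tuple (if j == i then ~~ tnth w j else tnth w j) | j < k].

Lemma flipK k (i : 'I_k) : involutive (flip i).
Proof.
move=> w; apply: eq_from_tnth => j; rewrite !tnth_mktuple.
by case: (j == i) => //; rewrite negbK.
Qed.

(** Pairing each word with its flip cancels the sum. *)
Lemma sum_flip0 k (i : 'I_k) (F : k.-tuple bool -> R) :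
  (forall w, F (flip i w) = - F w) -> \sum_w F w = 0.
Proof.
move=> FN; have : \sum_w F w = \sum_w F (flip i w).
  by apply: reindex_inj; exact/inv_inj/flipK.
under [in RHS]eq_bigr do rewrite FN.
by rewrite sumrN; lra.
Qed.

Lemma cvg_mean_sgn x : normal_seq R x -> mean (fun m => sgn_of (x m)) @ \oo --> 0.
Proof.
move=> nx.
rewrite (@eq_mean _ _ (fun m => sgn_of (tnth (window x 1 m) ord0))).
  apply: (@cvg_mean_window x 1 (fun w => sgn_of (tnth w ord0))) => //.
  by apply: (@sum_flip0 1 ord0) => w; rewrite tnth_mktuple eqxx sgn_ofN.
by move=> m _; rewrite tnth_window addn0.
Qed.

(** The product of two distinct coordinates of a word changes sign when one of
them is flipped, so it sums to [0] over all words. *)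
Lemma cvg_mean_sgnM x i j : normal_seq R x -> i != j ->
  mean (fun m => sgn_of (x (m + i)%N) * sgn_of (x (m + j)%N)) @ \oo --> 0.
Proof.
move=> nx ij; pose k := (maxn i j).+1.
have ik : (i < k)%N by rewrite ltnS leq_maxl.
have jk : (j < k)%N by rewrite ltnS leq_maxr.
pose i' := Ordinal ik; pose j' := Ordinal jk.
pose F (w : k.-tuple bool) := sgn_of (tnth w i') * sgn_of (tnth w j').
rewrite (@eq_mean _ _ (fun m => F (window x k m))).
  apply: cvg_mean_window => //; apply: (@sum_flip0 k i') => w.
  rewrite /F !tnth_mktuple eqxx sgn_ofN mulNr.
  by rewrite -val_eqE/= eq_sym (negbTE ij).
by move=> m _; rewrite /F !tnth_window.
Qed.

End Normal.

(** * Upper density *)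

Section Density.
Context {R : realType}.
Implicit Types V : set nat.

Let ind V : nat -> R := fun m => (m \in V)%:R.

Lemma countE V n :
  (count (fun m => m \in V) (iota 1 n))%:R / n%:R = mean (ind V) n.
Proof.
rewrite /mean /ind /index_iota subn1/=; congr (_ / _).
by rewrite -sum1_count natr_sum big_mkcond/=; apply: eq_bigr => m _; case: ifP.
Qed.

Lemma upper_densityE V : upper_density R V = limn_sup (mean (ind V)).
Proof. by congr limn_sup; apply/funext => n; rewrite countE. Qed.

(** A limit superior that is not positive forces the nonnegative frequencies to
converge to [0], since [sups u] dominates [u]. *)
Lemma cvg_mean_null V : ~ (0 < upper_density R V) ->
  mean (fun m => (m \in V)%:R : R) @ \oo --> 0.
Proof.
rewrite upper_densityE => /negP; rewrite -leNgt => ud.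
set u := mean _.
have u01 n : 0 <= u n <= 1.
  rewrite mean_ge0; last by move=> m _; rewrite ler0n.
  case: n => [|n]; first by rewrite /u/mean invr0 mulr0 ler01.
  by apply: mean_le_cst => // m _; rewrite lern1 leq_b1.
have ub : bounded_fun u.
  exists 1; split=> // M M1 n _ /=; have /andP[h0 h1] := u01 n.
  by rewrite ger0_norm// (le_trans h1)// ltW.
have usup : has_ubound (range u) by exact: bounded_fun_has_ubound.
have uinf : has_lbound (range u) by exact: bounded_fun_has_lbound.
have sl : sups u @ \oo --> limn_sup u.
  by rewrite limn_supE//; exact: cvg_sups_inf.
have us n : u n <= sups u n.
  apply: ub_le_sup => //; last by exists n => /=.
  by exists 1 => _ [m _ <-]; have /andP[] := u01 m.
have l0 : limn_sup u = 0.
  apply/eqP; rewrite eq_le ud/=.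
  rewrite -(cvg_lim _ sl)//; apply: limr_ge; first by apply/cvg_ex; eexists; exact: sl.
  by apply: nearW => n; rewrite (le_trans _ (us n))//; have /andP[] := u01 n.
rewrite l0 in sl; apply: (squeeze_cvgr _ (cvg_cst 0) sl).
by apply: nearW => n; rewrite us andbT; have /andP[] := u01 n.
Qed.

Lemma upper_density_bounded0 V N : (forall m, V m -> (m < N)%N) ->
  upper_density R V = 0.
Proof.
move=> VN; rewrite upper_densityE.
suff h : mean (ind V) @ \oo --> 0 by rewrite (cvg_limn_inf_sup h).
have h2 : (fun n => N%:R * (2 * @harmonic R n)) @ \oo --> 0.
  rewrite -[X in _ --> X](mulr0 N%:R); apply: cvgMl_tmp.
  by rewrite -[X in _ --> X](mulr0 2); apply: cvgMl_tmp; exact: cvg_harmonic.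
apply: (squeeze_cvgr _ (cvg_cst 0) h2); near=> n.
have n0 : (0 < n)%N by near: n; exact: nbhs_infty_gt.
rewrite mean_ge0/=; last by move=> m _; rewrite ler0n.
apply: ler_pM; rewrite ?invr_ge0 ?sumr_ge0//; last first.
  rewrite /harmonic -[leLHS]mul1r ler_pdivrMr ?ltr0n// mulrAC.
  rewrite ler_pdivlMr ?ltr0n// mul1r -natrM ler_nat; lia.
rewrite -natr_sum ler_nat.
rewrite /index_iota subn1/= [leqLHS](_ : _ = count (fun m => m \in V) (iota 1 n)).
  rewrite -size_filter -[leqRHS](size_iota 0).
  apply: uniq_leq_size; first by rewrite filter_uniq// iota_uniq.
  by move=> m; rewrite mem_filter !mem_iota => /andP[/set_mem/VN].
by rewrite -sum1_count [RHS]big_mkcond/=; apply: eq_bigr => m _; case: ifP.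
Unshelve. all: by end_near. Qed.

End Density.

Lemma upper_density_unbounded (R : realType) (V : set nat) (N : nat) :
  0 < upper_density R V -> exists2 b, (N <= b)%N & V b.
Proof.
move=> Vpos; apply: contrapT => VN; move: Vpos.
rewrite (@upper_density_bounded0 R V N) ?ltxx// => m Vm.
by rewrite ltnNge; apply/negP => Nm; apply: VN; exists m.
Qed.

(** * Sums and products in a normal set *)

Lemma in_S (A : set nat) a b : (0 < b)%N ->
  (b \in S_ A a) = ((a + b)%N \in A) && ((a * b)%N \in A).
Proof.
move=> b0; apply/idP/andP.
  by move=> /set_mem[_ ? ?]; split; apply/mem_set.
by case=> /set_mem ? /set_mem ?; apply/mem_set; split.
Qed.

Lemma cvg_mean_sgn_shift (R : realType) (x : nat -> bool) i : normal_seq R x ->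
  mean (fun m => sgn_of (x (m + i)%N) : R) @ \oo --> 0.
Proof.
move=> nx; apply: (@cvg_mean_shift _ (fun m => sgn_of (x m)) 1) => [m|].
  by rewrite /sgn_of; case: (x m); rewrite ?normrN normr1.
exact: cvg_mean_sgn.
Qed.

(** The indicator of [x (a * b) = x (a + b)], as a polynomial in the signs. *)
Definition agree {R : realType} (x : nat -> bool) (a b : nat) : R :=
  (1 + sgn_of (x (a * b)%N) * sgn_of (x (a + b)%N)) / 2.

(** The pairs of equal signs are the pairs [(1, 1)], counted by [S_ A a], and the
pairs [(-1, -1)].  The two counts differ by half of the sum of all the signs,
which is negligible because both sign sequences have mean [0]. *)
Lemma cvg_mean_agree0 (R : realType) (A : set nat) a (x := fun m => m \in A) :
  normal_seq R x -> (0 < a)%N -> ~ (0 < upper_density R (S_ A a)) ->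
  mean (agree x a : nat -> R) @ \oo --> 0.
Proof.
move=> nx a0 /cvg_mean_null Snull.
pose p b : R := sgn_of (x (a * b)%N); pose q b : R := sgn_of (x (b + a)%N).
have -> : mean (agree x a) = fun n =>
    2 * mean (fun m => (m \in S_ A a)%:R : R) n +
    - 2^-1 * (mean p n + mean q n).
  apply/funext => n; rewrite -meanD -!meanZ -meanD; congr (_ n).
  apply: eq_mean => b b0; rewrite /agree /p /q in_S// [(b + a)%N]addnC.
  rewrite -/(x (a + b)%N) -/(x (a * b)%N) /sgn_of.
  by case: (x (a + b)%N); case: (x (a * b)%N) => /=; lra.
have pl : mean p @ \oo --> 0.
  apply: (@cvg_mean_multiples0 _ (fun m => sgn_of (x m))) => // [m|i j ij].
    exact: sgn_of_sqr.
  exact: cvg_mean_sgnM.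
have ql : mean q @ \oo --> 0 by exact: cvg_mean_sgn_shift.
rewrite [X in _ --> X](_ : 0 = 2 * 0 + - 2^-1 * (0 + 0)); last by ring.
by apply: cvgD; apply: cvgMl_tmp => //; exact: cvgD.
Qed.

(** If neither [a * b] nor [b + 1] is an exception to [x (a b) = - x (a + b)],
then [x (b + (a + 1)) = x (a^2 b)], because [a (b + 1) = a + a b].  The left-hand
side is the indicator that [x] is [1] at both [b + (a + 1)] and [b + a^2]. *)
Lemma agree_bound (R : realType) (x : nat -> bool) a b :
  (1 + sgn_of (x (b + a.+1)%N)) * (1 + sgn_of (x (b + a ^ 2)%N)) / 4 <=
  agree x a (a * b) + agree x a (b + 1) +
  (x (a ^ 2 + b)%N && x (a ^ 2 * b)%N)%:R :> R.
Proof.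
rewrite /agree /sgn_of mulnA mulnn mulnDr muln1 [(a + a * b)%N]addnC.
rewrite [(b + 1)%N]addnC addnA addn1 [(b + a.+1)%N]addnC [(b + _)%N]addnC.
case: (x (a.+1 + b)%N); case: (x (a ^ 2 + b)%N) => /=;
  case: (x (a ^ 2 * b)%N); case: (x (a * b + a)%N) => /=; lra.
Qed.

Lemma upper_density_S_gt0 (R : realType) (A : set nat) a :
  classical_normal R A -> (0 < a)%N ->
  0 < upper_density R (S_ A a) \/ 0 < upper_density R (S_ A (a ^ 2)%N).
Proof.
move=> hnormal a0; apply: contrapT => /not_orP[S1 S2].
pose x m := m \in A.
have e0 := cvg_mean_agree0 hnormal a0 S1.
have s0 := cvg_mean_null S2.
have agree01 b : 0 <= (agree x a b : R) <= 1.
  by rewrite /agree /sgn_of; case: (x _); case: (x _); apply/andP; split; lra.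
have e0s : mean (fun b => agree x a (b + 1) : R) @ \oo --> 0.
  apply: (@cvg_mean_shift _ (agree x a) 1) => // m.
  by have /andP[h0 h1] := agree01 m; rewrite ger0_norm.
have e0a : mean (fun b => agree x a (a * b) : R) @ \oo --> 0.
  by apply: cvg_mean_dilate0 => // m; have /andP[] := agree01 m.
pose r b : R := sgn_of (x (b + a.+1)%N); pose s b : R := sgn_of (x (b + a ^ 2)%N).
pose L b := (1 + r b) * (1 + s b) / 4.
have Ll : mean L @ \oo --> (4^-1 : R).
  have -> : mean L = fun n => 4^-1 * (mean (fun=> 1) n + mean r n + mean s n +
      mean (fun b => r b * s b) n).
    apply/funext => n; rewrite -!meanD -meanZ; congr (_ n).
    by apply: eq_mean => b _; rewrite /L; field.
  rewrite [X in _ --> X](_ : _ = 4^-1 * (1 + 0 + 0 + 0)); last by rewrite !addr0 mulr1.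
  apply: cvgMl_tmp; apply: cvgD; last first.
    (* [a + 1 = a^2] has no solution in the integers *)
    by apply: cvg_mean_sgnM => //; rewrite -mulnn; apply/eqP; case: (a) => [|[|c]]; lia.
  apply: cvgD; last exact: cvg_mean_sgn_shift.
  apply: cvgD; last exact: cvg_mean_sgn_shift.
  exact: cvg_mean_cst.
(* A set of density [1/4] is covered by three null sets. *)
have : (4^-1 : R) <= 0 + 0 + 0.
  have ul : (fun n => mean (fun b => agree x a (a * b)) n +
      mean (fun b => agree x a (b + 1)) n +
      mean (fun b => (b \in S_ A (a ^ 2))%:R) n) @ \oo --> (0 + 0 + 0 : R).
    by apply: cvgD => //; exact: cvgD.
  apply: (ler_cvg_to Ll ul).
  apply: nearW => n /=; rewrite -!meanD; apply: ler_mean => b b0.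
  by rewrite in_S//; exact: agree_bound.
lra.
Qed.

Theorem theorem7p26 (R : realType) (A : set nat) (hA : A `<=` posN)
    (hnormal : classical_normal R A) :
  (forall a : nat, posN a ->
     0 < upper_density R (S_ A a) \/ 0 < upper_density R (S_ A (a ^ 2)%N)) /\
  (forall N : nat, exists a b : nat,
     [/\ (N <= a)%N, (N <= b)%N, A (a + b)%N & A (a * b)%N]).
Proof.
have main a := @upper_density_S_gt0 R A a hnormal.
split=> // N.
have [Spos|Spos] := main N.+1 isT.
  have [b Nb [_ Aab Amul]] := upper_density_unbounded N Spos.
  by exists N.+1, b.
have [b Nb [_ Aab Amul]] := upper_density_unbounded N Spos.
by exists (N.+1 ^ 2)%N, b; split=> //; nia.
Qed.
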